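(* The Median-Plus mechanism for locating one facility on the real line is strategy-proof: if $f(I)$ denotes its output on instance $I=\langle (x_1,b_1),\dots,(x_n,b_n)\rangle$, then for every instance $I$, every agent $i$, and every misreport $b_i'\in[0,B]$, $$cost(f(I),(x_i,b_i))\le cost(f(I'),(x_i,b_i)),$$ where $I'$ is $I$ with $(x_i,b_i)$ replaced by $(x_i,b_i')$.
   Context: An instance with $n\ge1$ agents is $I=\langle (x_1,b_1),\dots,(x_n,b_n)\rangle$, where $x_i\in\mathbb{R}$ is the publicly known location of agent $i$ and $b_i\in[0,B]$ its private preferred distance. The cost of agent $i$ for facility location $y\in\mathbb{R}$ is $cost(y,(x_i,b_i))=|x_i-b_i-y|$ if $y\le x_i$ and $|x_i+b_i-y|$ if $y>x_i$ (equivalently $\big||x_i-y|-b_i\big|$). The median of $n$ items is the item of rank $\lfloor (n+1)/2\rfloor$ in increasing order. Ties among equal agent locations are resolved by a fixed ordering of the agents (independent of the reports), so that each agent has a unique rank. Median-Plus mechanism: let $\mathrm{med}$ be the median of $x_1,\dots,x_n$. For each agent $i$, set $p_i=x_i+b_i$ if $x_i\le\mathrm{med}$ and $p_i=x_i-b_i$ otherwise (for agents with $x_i=\mathrm{med}$ the comparison is resolved by the fixed ordering: $p_i=x_i+b_i$ exactly for agents of rank at most $\lfloor (n+1)/2\rfloor$). Output the median of $p_1,\dots,p_n$. *)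

(* Defs.v *)
From mathcomp Require Import all_boot all_order all_fingroup all_algebra.

Set Implicit Arguments.
Unset Strict Implicit.
Unset Printing Implicit Defensive.

Import Order.TTheory GRing.Theory Num.Theory.
Local Open Scope ring_scope.

(* The agents are the elements of 'I_n.  An instance is given by the public
   locations x : 'I_n -> R and the (reported) distances b : 'I_n -> R. *)

Definition cost (R : realFieldType) (y : R) (a : R * R) : R :=
  if y <= a.1 then `|a.1 - a.2 - y| else `|a.1 + a.2 - y|.

(* Ranks are counted from 1, while nth counts from 0.  The default value 0
   of nth is only reached when n = 0. *)
Definition median_rank (n : nat) : nat := ((n + 1) %/ 2)%N.

Definition median (R : realFieldType) (n : nat) (f : 'I_n -> R) : R :=
  nth 0 (sort <=%R [seq f i | i <- enum 'I_n]) (median_rank n).-1.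

(* The fixed ordering of the agents that breaks ties between equal locations
   is encoded by a permutation s: among agents at the same location, j comes
   before i when s j < s i. *)
Definition agent_rank (R : realFieldType) (n : nat) (s : {perm 'I_n})
    (x : 'I_n -> R) (i : 'I_n) : nat :=
  #|[set j | (x j < x i) || (x j == x i) && (s j <= s i)%N]|.

Definition at_most_median (R : realFieldType) (n : nat) (s : {perm 'I_n})
    (x : 'I_n -> R) (i : 'I_n) : bool :=
  (x i < median x)
  || (x i == median x) && (agent_rank s x i <= median_rank n)%N.

Definition median_plus (R : realFieldType) (n : nat) (s : {perm 'I_n})
    (x b : 'I_n -> R) : R :=
  median (fun i => if at_most_median s x i then x i + b i else x i - b i).

(* Main.v *)
Require Import Defs.
From mathcomp Require Import all_boot all_order all_fingroup all_algebra.
From mathcomp Require Import zify lra.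

Import Order.TTheory GRing.Theory Num.Theory.
Local Open Scope ring_scope.

(** A misreport of agent [i] changes only [p i], and the side of [x i] on which
    [p i] lies depends on public data alone.  If the output is the true [p i],
    the cost is zero.  If the output lies strictly on one side of the true
    [p i], a misreport can only move it further away from there, and never past
    the misreported [p i].  As the latter lies on the same side of [x i] as the
    true one, an output that moves in the direction of [x i] stops before [x i],
    and never approaches the second ideal point of agent [i] beyond it. *)

Lemma median_index_lt (n : nat) : (0 < n)%N -> ((median_rank n).-1 < n)%N.
Proof. by rewrite /median_rank; lia. Qed.

(** Counts ignore order, so this form of the comparison removes the sorting: medians of two profiles
    can then be compared agent by agent. *)
Lemma le_median (R : realFieldType) (n : nat) (f : 'I_n -> R) (t : R) :
  (0 < n)%N ->
  (t <= median f)
  = (count (fun j => (f j < t)%R) (enum 'I_n) <= (median_rank n).-1)%N.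
Proof.
move=> n_gt0; rewrite /median; set l := sort _ _.
have l_sorted : sorted <=%O l by apply: sort_le_sorted.
have <- : count (< t) l = count (fun j => f j < t) (enum 'I_n).
  by rewrite count_sort count_map.
apply/idP/idP => [|count_le].
  rewrite leNgt; apply: contraR; rewrite -ltnNge.
  by move=> /(nth_count_lt 0 l_sorted).
apply: nth_count_ge => //.
by rewrite count_le size_sort size_map size_enum_ord median_index_lt.
Qed.

Lemma median_le (R : realFieldType) (n : nat) (f : 'I_n -> R) (t : R) :
  (0 < n)%N ->
  (median f <= t)
  = ((median_rank n).-1 < count (fun j => (f j <= t)%R) (enum 'I_n))%N.
Proof.
move=> n_gt0; rewrite /median; set l := sort _ _.
have l_sorted : sorted <=%O l by apply: sort_le_sorted.
have <- : count (<= t) l = count (fun j => f j <= t) (enum 'I_n).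
  by rewrite count_sort count_map.
apply/idP/idP => [|/(nth_count_le 0 l_sorted) //].
rewrite leNgt; apply: contraR; rewrite -leqNgt => count_le.
apply: nth_count_gt => //.
by rewrite count_le size_sort size_map size_enum_ord median_index_lt.
Qed.

(** Agent [i] already counts as strictly below the median, so no [g i] can raise that count; a
    threshold raised to at least [g i] still counts agent [i] as at most it. *)
Lemma median_update_below (R : realFieldType) (n : nat) (f g : 'I_n -> R)
    (i : 'I_n) :
  (0 < n)%N -> (forall j, j != i -> g j = f j) -> f i < median f ->
  median f <= median g <= Num.max (median f) (g i).
Proof.
move=> n_gt0 fg lt_fi; rewrite le_median // median_le //; apply/andP; split.
  apply: leq_trans (_ : _ <= count (fun j => (f j < median f)%R) (enum 'I_n))%N _.
    by apply: sub_count => j; have [->//|/fg ->] := eqVneq j i.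
  by rewrite -le_median.
apply: leq_trans (_ : _ <= count (fun j => (f j <= median f)%R) (enum 'I_n))%N _.
  by rewrite -median_le.
apply: sub_count => j /=; rewrite le_max.
by have [->|/fg -> ->] := eqVneq j i; rewrite ?lexx ?orbT.
Qed.

Lemma median_update_above (R : realFieldType) (n : nat) (f g : 'I_n -> R)
    (i : 'I_n) :
  (0 < n)%N -> (forall j, j != i -> g j = f j) -> median f < f i ->
  Num.min (median f) (g i) <= median g <= median f.
Proof.
move=> n_gt0 fg lt_fi; rewrite le_median // median_le //; apply/andP; split.
  apply: leq_trans (_ : _ <= count (fun j => (f j < median f)%R) (enum 'I_n))%N _.
    apply: sub_count => j /=; rewrite lt_min.
    (* No value lies strictly below a minimum that includes it, so agent [i] adds nothing to the
       count for [g]. *)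
    by have [->|/fg -> /andP[]//] := eqVneq j i; rewrite ltxx andbF.
  by rewrite -le_median.
apply: leq_trans (_ : _ <= count (fun j => (f j <= median f)%R) (enum 'I_n))%N _.
  by rewrite -median_le.
by apply: sub_count => j /=; have [->|/fg -> //] := eqVneq j i; rewrite leNgt lt_fi.
Qed.

Lemma cost_left (R : realFieldType) (y x b : R) :
  y <= x -> cost y (x, b) = `|x - b - y|.
Proof. by rewrite /cost /= => ->. Qed.

Lemma cost_right (R : realFieldType) (y x b : R) :
  x <= y -> cost y (x, b) = `|x + b - y|.
Proof.
rewrite /cost /=; case: ifP => // y_le x_le.
(* At [y = x], which [cost] gives to its left branch, both formulas equal the absolute value of
   [b]. *)
have -> : y = x by apply: le_anti; rewrite y_le.
by rewrite addrAC subrr add0r normrN addrAC subrr add0r.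
Qed.

(** The two implications have the shape of the update lemmas, with [x + b] and [x + b'] as old and
    new value of agent [i]. *)
Lemma cost_plus_median (R : realFieldType) (x b b' y y' : R) :
  0 <= b -> 0 <= b' ->
  (x + b < y -> y <= y' <= Num.max y (x + b')) ->
  (y < x + b -> Num.min y (x + b') <= y' <= y) ->
  cost y (x, b) <= cost y' (x, b).
Proof.
move=> b_ge0 b'_ge0; rewrite ge_min.
have [y_gt|y_lt|<-] := ltgtP (x + b) y.
- move=> /(_ isT) /andP[y_le _] _; rewrite !cost_right; try lra.
  by rewrite !ler0_norm; lra.
- move=> _ /(_ isT) /andP[/orP[y_le|y'_ge] y_ge].
    by have -> : y' = y by apply: le_anti; rewrite y_le y_ge.
  (* Here [x <= x + b' <= y' <= y < x + b], so both costs are distances to [x + b]. *)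
  by rewrite !cost_right ?ger0_norm; lra.
- by rewrite cost_right ?lerDl // subrr normr0 /cost; case: ifP.
Qed.

(** The mirror image: now an upward move heads for [x], and [x - b'] stops it. *)
Lemma cost_minus_median (R : realFieldType) (x b b' y y' : R) :
  0 <= b -> 0 <= b' ->
  (x - b < y -> y <= y' <= Num.max y (x - b')) ->
  (y < x - b -> Num.min y (x - b') <= y' <= y) ->
  cost y (x, b) <= cost y' (x, b).
Proof.
move=> b_ge0 b'_ge0; rewrite le_max.
have [y_gt|y_lt|<-] := ltgtP (x - b) y.
- move=> /(_ isT) /andP[y_le /orP[y_ge|y'_le]] _.
    by have -> : y' = y by apply: le_anti; rewrite y_le y_ge.
  by rewrite !cost_left ?ler0_norm; lra.
- move=> _ /(_ isT) /andP[_ y_ge]; rewrite !cost_left; try lra.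
  by rewrite !ger0_norm; lra.
- by rewrite cost_left ?gerBl // subrr normr0 /cost; case: ifP.
Qed.

Theorem lemma7 (R : realFieldType) (n : nat) (n_ge1 : (1 <= n)%N) (B : R)
    (s : {perm 'I_n}) (x b : 'I_n -> R)
    (b_range : forall j : 'I_n, 0 <= b j <= B)
    (i : 'I_n) (b' : R) (b'_range : 0 <= b' <= B) :
  cost (median_plus s x b) (x i, b i)
    <= cost (median_plus s x [eta b with i |-> b']) (x i, b i).
Proof.
rewrite /median_plus; set f := (fun j => _); set g := (fun j => _).
have fg j : j != i -> g j = f j by move=> /negbTE ji; rewrite /g /f /= ji.
have bi_ge0 : 0 <= b i by case/andP: (b_range i).
have b'_ge0 : 0 <= b' by case/andP: b'_range.
have fi : f i = if at_most_median s x i then x i + b i else x i - b i by [].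
have gi : g i = if at_most_median s x i then x i + b' else x i - b'.
  by rewrite /g /= eqxx.
have := median_update_above _ _ f g i n_ge1 fg.
have := median_update_below _ _ f g i n_ge1 fg.
(* The test reads only [s] and [x], so one case split settles both [f i] and [g i]. *)
rewrite fi gi; case: ifP => _.
  exact: cost_plus_median.
exact: cost_minus_median.
Qed.
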